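(* Let $N,d\in\mathbb N$, let $W_1,W_2\in\mathbb R^{N\times N}$ be doubly stochastic matrices with consensus-contraction rates $\lambda_1,\lambda_2$ satisfying $0<\lambda_1,\lambda_2<1$, and let $c_1,c_2>0$ be the per-round token costs of modes $1$ and $2$ respectively. Let $(\mathbf X_k)_{k\ge 0}$ in $\mathbb R^{N\times d}$ be the trajectory of $\mathbf X_{k+1}=W_{\sigma_k}\mathbf X_k$ under the norm-threshold switching rule $\sigma_k=1$ if $D(k)>\eta$ and $\sigma_k=2$ if $D(k)\le\eta$. Assume $D(0)>\eta>\varepsilon>0$. Define $$K_1:=\left\lceil\frac{\log(\eta/D(0))}{\log\lambda_1}\right\rceil,\qquad K_2:=\left\lceil\frac{\log(\varepsilon/\eta)}{\log\lambda_2}\right\rceil,\qquad K^*=K_1+K_2 .$$ Then: 1. During the high-disagreement phase, $D(k)\le\lambda_1^kD(0)$ for $0<k<K_1$. 2. During the low-disagreement phase, $D(k)\le\lambda_2^{\,k-K_1}\eta$ for $k\ge K_1>0$. 3. The trajectory reaches $\varepsilon$-consensus in at most $K^*$ rounds: $D(K^* )\le\varepsilon$. 4. The corresponding communication cost (total token expenditure) is $B^*=K_1c_1+K_2c_2$.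
   Context: A real matrix is doubly stochastic if its entries are nonnegative and every row and every column sums to $1$. Let $\mathbf 1\in\mathbb R^N$ be the all-ones column vector, $\mathbf 1^\perp=\{v\in\mathbb R^N:\mathbf 1^\top v=0\}$ and $P=I-\frac1N\mathbf 1\mathbf 1^\top$. For a doubly stochastic $W_\sigma$ (which maps $\mathbf 1^\perp$ into itself), the consensus-contraction rate is $\lambda_\sigma:=\|W_\sigma|_{\mathbf 1^\perp}\|_2$, i.e. the smallest constant with $\|W_\sigma v\|_2\le\lambda_\sigma\|v\|_2$ for all $v\in\mathbf 1^\perp$. The state $\mathbf X_k\in\mathbb R^{N\times d}$ has as rows the belief vectors of $N$ agents at communication round $k\in\mathbb Z_{\ge0}$. The disagreement is $D(k)=\frac{1}{\sqrt N}\|P\mathbf X_k\|_F$ (Frobenius norm); $\varepsilon$-consensus at round $k$ means $D(k)\le\varepsilon$. Each communication round in mode $\sigma\in\{1,2\}$ costs $c_\sigma$ tokens.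
   Formalization: Item 4 fails if D drops to η or below before round K1; the formal version gives B* as the cost of K1 mode-1 then K2 mode-2 rounds, as the trajectory's own cost if D(k)>η for all k<K1, and always as an upper bound on the cost up to first ε-consensus. *)

(* Defs.v *)
From HB Require Import structures.
From mathcomp Require Import all_boot all_order all_algebra.
From mathcomp Require Import classical_sets reals exp.

Set Implicit Arguments.
Unset Strict Implicit.
Unset Printing Implicit Defensive.

Import Order.TTheory GRing.Theory Num.Theory.
Local Open Scope classical_set_scope.
Local Open Scope ring_scope.

Inductive mode := mode1 | mode2.

(* On column vectors this is the Euclidean norm. The norm `|A| that
   MathComp-Analysis puts on matrices is the max norm, hence not used here. *)
Definition frobenius_norm (R : realType) (m n : nat) (A : 'M[R]_(m, n)) : R :=
  Num.sqrt (\sum_i \sum_j A i j ^+ 2).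

Definition doubly_stochastic (R : realType) (N : nat) (W : 'M[R]_N) : Prop :=
  [/\ forall i j, 0 <= W i j,
      forall i, \sum_j W i j = 1
    & forall j, \sum_i W i j = 1].

Definition ones (R : realType) (N : nat) : 'cV[R]_N := const_mx 1.

Definition ones_perp (R : realType) (N : nat) : set 'cV[R]_N :=
  [set v | (ones R N)^T *m v = 0].

Definition centering (R : realType) (N : nat) : 'M[R]_N :=
  1%:M - N%:R^-1 *: (ones R N *m (ones R N)^T).

(* The set is nonempty, bounded below and closed, so the infimum is its least
   element. The condition 0 <= l only matters when ones_perp is {0}. *)
Definition contraction_rate (R : realType) (N : nat) (W : 'M[R]_N) : R :=
  inf [set l : R | 0 <= l /\ forall v : 'cV[R]_N, ones_perp v ->
                     frobenius_norm (W *m v) <= l * frobenius_norm v].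

Definition disagreement (R : realType) (N d : nat) (X : 'M[R]_(N, d)) : R :=
  (Num.sqrt N%:R)^-1 * frobenius_norm (centering R N *m X).

Definition consensus (R : realType) (N d : nat) (eps : R) (X : 'M[R]_(N, d)) :
  Prop := disagreement X <= eps.

Definition switching_rule (R : realType) (N d : nat) (eta : R)
    (X : 'M[R]_(N, d)) : mode :=
  if eta < disagreement X then mode1 else mode2.

Definition is_trajectory (R : realType) (N d : nat) (W : mode -> 'M[R]_N)
    (eta : R) (X : nat -> 'M[R]_(N, d)) : Prop :=
  forall k, X k.+1 = W (switching_rule eta (X k)) *m X k.

(* ceil (ln (b / a) / ln lambda), the number of contractions by lambda that
   bring a down to b. For 0 < b < a and 0 < lambda < 1 the ceiling is a positive
   integer, so that the absolute value only casts it from int to nat. *)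
Definition phase_length (R : realType) (lambda a b : R) : nat :=
  `|Num.ceil (ln (b / a) / ln lambda)|%N.

Definition token_cost (R : realType) (c : mode -> R) (sigma : nat -> mode)
    (K : nat) : R :=
  \sum_(0 <= k < K) c (sigma k).

(* The schedule whose high-disagreement phase consists of exactly the rounds
   k < K1. A trajectory may cross the threshold earlier than round K1, in which
   case its own modes differ from this schedule. *)
Definition two_phase (K1 : nat) (k : nat) : mode :=
  if (k < K1)%N then mode1 else mode2.

(* Main.v *)
(** Since [W] commutes with the centering matrix, each round contracts the
    disagreement [D] by the rate of the current mode. Let [m] be the first round
    at which [D <= eta]; then [m <= K1], as [lambda1 ^ K1 * D 0 <= eta]. Modes
    are [mode1] before round [m] and [mode2] from then on, because a contraction
    never brings [D] above [eta] again. When [m < K1], the bounds of both phases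
    survive: [eta < lambda1 ^ k * D 0] as long as [k < K1], and starting the
    second contraction early only helps. *)
Require Import Defs.
From HB Require Import structures.
From mathcomp Require Import all_boot all_order all_algebra.
From mathcomp Require Import boolp classical_sets reals exp.

Import Order.TTheory GRing.Theory Num.Theory.
Local Open Scope ring_scope.

Lemma frobenius_norm_ge0 (R : realType) (m n : nat) (A : 'M[R]_(m, n)) :
  0 <= frobenius_norm A.
Proof. exact: sqrtr_ge0. Qed.

(** The rate is defined on single vectors; this carries it over to matrices column by column. *)
Lemma frobenius_norm_sqr (R : realType) (m n : nat) (A : 'M[R]_(m, n)) :
  frobenius_norm A ^+ 2 = \sum_j frobenius_norm (col j A) ^+ 2.
Proof.
have sqE p q (B : 'M[R]_(p, q)) :
    frobenius_norm B ^+ 2 = \sum_i \sum_j B i j ^+ 2.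
  by rewrite sqr_sqrtr //; do 2!apply: sumr_ge0 => ? _; exact: sqr_ge0.
rewrite sqE exchange_big; apply: eq_bigr => j _; rewrite sqE.
by apply: eq_bigr => i _; rewrite big_ord1 mxE.
Qed.

(* A positive rate comes from a nonempty set, as the infimum of an empty set is
   0: no a priori bound on [W] is needed. *)
Lemma contraction_rateP (R : realType) (N : nat) (W : 'M[R]_N) (v : 'cV[R]_N) :
  0 < contraction_rate W -> ones_perp v ->
  frobenius_norm (W *m v) <= contraction_rate W * frobenius_norm v.
Proof.
rewrite /contraction_rate; set S := [set l | _]%classic => S_gt0 v_perp.
have [S_neq0 _] : has_inf S.
  by apply: contrapT => /inf_out S0; rewrite S0 ltxx in S_gt0.
(* If [v] has norm 0, any member of [S] gives the bound. Otherwise dividing by the norm turns the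
   claim into: the ratio of the two norms is a lower bound of [S]. *)
have [v0|v_neq0] := eqVneq (frobenius_norm v) 0.
  by case: S_neq0 => l [_ /(_ v v_perp)]; rewrite v0 !mulr0.
have v_gt0 : 0 < frobenius_norm v by rewrite lt_neqAle eq_sym v_neq0 frobenius_norm_ge0.
rewrite -ler_pdivrMr //; apply: lb_le_inf => // l [_ /(_ v v_perp)].
by rewrite ler_pdivrMr.
Qed.

Lemma doubly_stochastic_mulmx_ones (R : realType) (N : nat) (W : 'M[R]_N) :
  doubly_stochastic W -> W *m ones R N = ones R N.
Proof.
case=> _ rowW _; apply/matrixP => i j; rewrite !mxE -[RHS](rowW i).
by apply: eq_bigr => k _; rewrite mxE mulr1.
Qed.

Lemma doubly_stochastic_ones_mulmx (R : realType) (N : nat) (W : 'M[R]_N) :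
  doubly_stochastic W -> (ones R N)^T *m W = (ones R N)^T.
Proof.
case=> _ _ colW; apply/matrixP => i j; rewrite !mxE -[RHS](colW j).
by apply: eq_bigr => k _; rewrite !mxE mul1r.
Qed.

Lemma centering_mulmxC (R : realType) (N : nat) (W : 'M[R]_N) :
  doubly_stochastic W -> centering R N *m W = W *m centering R N.
Proof.
move=> W_ds; rewrite /centering mulmxBl mulmxBr mul1mx mulmx1.
rewrite -scalemxAl -scalemxAr -mulmxA doubly_stochastic_ones_mulmx //.
by rewrite mulmxA doubly_stochastic_mulmx_ones.
Qed.

Lemma ones_mulmx_centering (R : realType) (N : nat) :
  (ones R N)^T *m centering R N = 0.
Proof.
rewrite /centering mulmxBr mulmx1 -scalemxAr mulmxA.
apply/matrixP => i j; rewrite !mxE big_ord1 !mxE.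
under eq_bigr do rewrite !mxE mulr1.
rewrite sumr_const card_ord mulr1 mulVf ?subrr // pnatr_eq0.
(* The index [j] rules out [N = 0], where the inverse of [N%:R] would be the default 0. *)
by case: N j => [[]|].
Qed.

(** Once [W] is moved past the centering matrix, it acts on the columns of the centered state. Each
    of these lies in [ones_perp], so it contracts by the rate, and the squares add up. *)
Lemma disagreement_mulmx (R : realType) (N d : nat) (W : 'M[R]_N)
    (X : 'M[R]_(N, d)) :
  doubly_stochastic W -> 0 < contraction_rate W ->
  disagreement (W *m X) <= contraction_rate W * disagreement X.
Proof.
move=> W_ds rate_gt0; rewrite /disagreement mulrCA.
apply: ler_wpM2l; first by rewrite invr_ge0 sqrtr_ge0.
rewrite mulmxA centering_mulmxC // -mulmxA.
set Y := centering R N *m X.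
rewrite -ler_sqr ?nnegrE ?mulr_ge0 ?frobenius_norm_ge0 ?(ltW rate_gt0) //.
rewrite exprMn 2!frobenius_norm_sqr mulr_sumr; apply: ler_sum => j _.
rewrite -exprMn ler_sqr ?nnegrE ?mulr_ge0 ?frobenius_norm_ge0 ?(ltW rate_gt0) //.
rewrite colE -mulmxA -colE; apply: contraction_rateP => //.
by rewrite /ones_perp /= colE !mulmxA ones_mulmx_centering !mul0mx.
Qed.

(** Dividing by [ln l < 0] reverses the inequality between logarithms. Being an equivalence, it also
    yields [b < l ^+ k * a] for every [k] below the phase length. *)
Lemma phase_length_le (R : realType) (l a b : R) (k : nat) :
  0 < l < 1 -> 0 < b < a -> (phase_length l a b <= k)%N = (l ^+ k * a <= b).
Proof.
move=> /andP[l_gt0 l_lt1] /andP[b_gt0 b_lta].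
have a_gt0 : 0 < a := lt_trans b_gt0 b_lta.
have ba_gt0 : 0 < b / a by rewrite divr_gt0.
have lnl_lt0 : ln l < 0 by rewrite ln_lt0 // l_gt0.
have lnba_lt0 : ln (b / a) < 0 by rewrite ln_lt0 // ba_gt0 ltr_pdivrMr ?mul1r.
have q_ge0 : 0 <= ln (b / a) / ln l by rewrite ltW // nmulr_rgt0 ?invr_lt0.
rewrite /phase_length -lez_nat gez0_abs; last first.
  by rewrite -(ler_int R); exact: le_trans (ceil_ge _).
rewrite ceil_le_int ler_ndivrMr // mulr_natl -lnXn //.
by rewrite ler_ln ?posrE ?exprn_gt0 // ler_pdivlMr.
Qed.

Lemma phase_length_gt0 (R : realType) (l a b : R) :
  0 < l < 1 -> 0 < b < a -> (0 < phase_length l a b)%N.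
Proof.
move=> l01 ba; rewrite ltnNge phase_length_le // expr0 mul1r -ltNge.
by case/andP: ba.
Qed.

Lemma high_phase_le (R : realType) (D : nat -> R) (l1 l2 eta : R) (k : nat) :
  0 <= l1 -> (forall i, D i.+1 <= (if eta < D i then l1 else l2) * D i) ->
  (forall i, (i < k)%N -> eta < D i) -> D k <= l1 ^+ k * D 0%N.
Proof.
move=> l1_ge0 stepD; elim: k => [|k IHk] highD; first by rewrite expr0 mul1r.
apply: le_trans (stepD k) _; rewrite highD // exprS -mulrA ler_wpM2l // IHk //.
by move=> i /ltnW; exact: highD.
Qed.

(** As [l2 <= 1], the bound [l2 ^+ j * eta] never exceeds [eta], so the induction hypothesis itself
    keeps the next round in the low phase. *)
Lemma low_phase_le (R : realType) (D : nat -> R) (l1 l2 eta : R) (m j : nat) :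
  0 <= l2 <= 1 -> 0 <= eta ->
  (forall i, D i.+1 <= (if eta < D i then l1 else l2) * D i) ->
  D m <= eta -> D (m + j)%N <= l2 ^+ j * eta.
Proof.
move=> /andP[l2_ge0 l2_le1] eta_ge0 stepD Dm.
elim: j => [|j IHj]; first by rewrite addn0 expr0 mul1r.
have /(le_trans IHj) : l2 ^+ j * eta <= eta by rewrite ler_piMl // exprn_ile1.
rewrite leNgt => /negbTE lowD; rewrite addnS exprS -mulrA.
by apply: le_trans (stepD _) _; rewrite lowD ler_wpM2l.
Qed.

Lemma first_crossing (R : realType) (D : nat -> R) (l1 l2 eta : R) (K : nat) :
  0 <= l1 -> (forall i, D i.+1 <= (if eta < D i then l1 else l2) * D i) ->
  l1 ^+ K * D 0%N <= eta ->
  exists2 m, (m <= K)%N & D m <= eta /\ forall i, (i < m)%N -> eta < D i.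
Proof.
move=> l1_ge0 stepD l1K.
(* The disjunct [i == K] makes a minimum exist before any crossing is known. If the minimum is [K],
   all earlier rounds are high and [high_phase_le] gives the crossing at [K]. *)
have exm : exists i, (D i <= eta) || (i == K) by exists K; rewrite eqxx orbT.
case: (ex_minnP exm) => m Pm minm; exists m; first by rewrite minm ?eqxx ?orbT.
have highD i : (i < m)%N -> eta < D i.
  by move=> im; rewrite ltNge; apply: contraL im => Di; rewrite -leqNgt minm ?Di.
split=> //; case/orP: Pm => // /eqP mK; rewrite -mK in l1K.
exact: le_trans (high_phase_le _ _ _ _ _ _ l1_ge0 stepD highD) l1K.
Qed.

Lemma token_cost_split (R : realType) (c : mode -> R) (sigma : nat -> mode)
    (m n : nat) :
  (forall k, (k < m)%N -> sigma k = mode1) ->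
  (forall k, (m <= k < m + n)%N -> sigma k = mode2) ->
  token_cost c sigma (m + n) = m%:R * c mode1 + n%:R * c mode2.
Proof.
move=> sigma1 sigma2; rewrite /token_cost (@big_cat_nat _ _ _ m) ?leq_addr //=.
rewrite (eq_big_nat _ _ (F2 := fun=> c mode1)); last first.
  by move=> k km; rewrite sigma1.
rewrite [X in _ + X](eq_big_nat _ _ (F2 := fun=> c mode2)); last first.
  by move=> k km; rewrite sigma2.
by rewrite !sumr_const_nat subn0 addKn !mulr_natl.
Qed.

Theorem theorem1 (R : realType) (N d : nat) (W : mode -> 'M[R]_N)
    (c : mode -> R) (eta eps : R) (X : nat -> 'M[R]_(N, d))
    (W_ds : forall s, doubly_stochastic (W s))
    (rate_bounds : forall s, 0 < contraction_rate (W s) < 1)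
    (c_gt0 : forall s, 0 < c s)
    (X_traj : is_trajectory W eta X)
    (eps_gt0 : 0 < eps) (eps_lt_eta : eps < eta)
    (eta_lt_D0 : eta < disagreement (X 0%N)) :
  let lambda s := contraction_rate (W s) in
  let D k := disagreement (X k) in
  let sigma k := switching_rule eta (X k) in
  let K1 := phase_length (lambda mode1) (D 0%N) eta in
  let K2 := phase_length (lambda mode2) eta eps in
  let Kstar := (K1 + K2)%N in
  let Bstar := K1%:R * c mode1 + K2%:R * c mode2 in
  [/\ (* 1: high-disagreement phase *)
      forall k, (0 < k < K1)%N -> D k <= lambda mode1 ^+ k * D 0%N,
      (* 2: low-disagreement phase *)
      (0 < K1)%N /\
      forall k, (K1 <= k)%N -> D k <= lambda mode2 ^+ (k - K1)%N * eta,
      (* 3: eps-consensus after Kstar rounds *)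
      consensus eps (X Kstar)
    & (* 4: cost of the Kstar rounds, K1 in mode 1 and then K2 in mode 2;
         this is the trajectory's own expenditure when its high-disagreement
         phase lasts K1 rounds, and in all cases an upper bound on what the
         trajectory spends until it first reaches eps-consensus *)
      [/\ token_cost c (two_phase K1) Kstar = Bstar,
          (forall k, (k < K1)%N -> eta < D k) ->
            token_cost c sigma Kstar = Bstar
        & forall T, consensus eps (X T) ->
            (forall k, (k < T)%N -> ~ consensus eps (X k)) ->
            token_cost c sigma T <= Bstar]].
Proof.
move=> lambda D sigma K1 K2 Kstar Bstar.
have eta_gt0 : 0 < eta := lt_trans eps_gt0 eps_lt_eta.
have lambda_ge0 s : 0 <= lambda s by case/andP: (rate_bounds s) => /ltW.
have lambda2_ge0le1 : 0 <= lambda mode2 <= 1.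
  by case/andP: (rate_bounds mode2) => l0 l1; rewrite !ltW.
have stepD k :
    D k.+1 <= (if eta < D k then lambda mode1 else lambda mode2) * D k.
  have <- : lambda (sigma k) = if eta < D k then lambda mode1 else lambda mode2.
    by rewrite /sigma /switching_rule -/(D k); case: ifP.
  rewrite /D X_traj; apply: disagreement_mulmx => //.
  by case/andP: (rate_bounds (sigma k)).
have K1P k : (K1 <= k)%N = (lambda mode1 ^+ k * D 0%N <= eta).
  by rewrite phase_length_le ?rate_bounds ?eta_gt0.
have K2P k : (K2 <= k)%N = (lambda mode2 ^+ k * eta <= eps).
  by rewrite phase_length_le ?rate_bounds ?eps_gt0.
have low m j : D m <= eta -> D (m + j)%N <= lambda mode2 ^+ j * eta.
  by apply: low_phase_le stepD; rewrite // ltW.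
have stay m k : D m <= eta -> (m <= k)%N -> D k <= eta.
  move=> Dm mk; rewrite -(subnKC mk); apply: le_trans (low _ _ Dm) _.
  by rewrite ler_piMl ?(ltW eta_gt0) // exprn_ile1; case/andP: lambda2_ge0le1.
have lowsigma k : D k <= eta -> sigma k = mode2.
  by rewrite /sigma /switching_rule -/(D k) ltNge => ->.
have highsigma k : eta < D k -> sigma k = mode1.
  by rewrite /sigma /switching_rule -/(D k) => ->.
have [|m mK1 [Dm highD]] := first_crossing _ _ _ _ _ K1 (lambda_ge0 mode1) stepD.
  by rewrite -K1P leqnn.
have DK1 : D K1 <= eta := stay _ _ Dm mK1.
have lowK1 k : (K1 <= k)%N -> D k <= lambda mode2 ^+ (k - K1) * eta.
  by move=> K1k; rewrite -[in D k](subnKC K1k) low.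
split=> //.
- move=> k /andP[_ kK1]; have [km|mk] := leqP k m.
    apply: high_phase_le stepD _ => // i ik.
    exact: highD (leq_trans ik km).
  apply: le_trans (stay _ _ Dm (ltnW mk)) _.
  by rewrite ltW // ltNge -K1P -ltnNge.
- split; last exact: lowK1.
  by rewrite phase_length_gt0 ?rate_bounds ?eta_gt0.
- rewrite /consensus -/(D Kstar); apply: le_trans (lowK1 _ (leq_addr _ _)) _.
  by rewrite addKn -K2P leqnn.
split.
- apply: token_cost_split => k; rewrite /two_phase; first by move=> ->.
  by case/andP=> K1k _; rewrite ltnNge K1k.
- move=> highK1; apply: token_cost_split => k; first by move/highK1/highsigma.
  by case/andP=> K1k _; apply: lowsigma (stay _ _ DK1 K1k).
(* The first consensus round [T] satisfies [m <= T <= m + K2]: consensus forces [D T <= eta], and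
   [K2] low rounds after [m] suffice. The trajectory thus spends [m <= K1] rounds in [mode1] and
   [T - m <= K2] in [mode2]. *)
move=> T DT minT.
have mT : (m <= T)%N.
  rewrite leqNgt; apply/negP => /highD; apply/negP; rewrite -leNgt.
  exact: le_trans DT (ltW eps_lt_eta).
have TmK2 : (T - m <= K2)%N.
  rewrite leq_subLR leqNgt; apply/negP => /minT; apply.
  by apply: le_trans (low _ _ Dm) _; rewrite -K2P leqnn.
rewrite -(subnKC mT) token_cost_split.
- by rewrite lerD // ler_wpM2r ?ler_nat ?(ltW (c_gt0 _)).
- by move=> k /highD/highsigma.
- by move=> k /andP[mk _]; apply: lowsigma (stay _ _ Dm mk).
Qed.
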